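(* Let $d\ge2$ and let $\tau$ be the cyclic ordering of $T=2$ tasks. After $k=2n\ge 2$ iterations, $$\sup_{S\in\mathcal{S}_2}F_{\tau,S}(k)=\frac{1}{2e(k-1)}-\frac{1}{4e(k-1)^2}+O\!\left(\frac{1}{k^3}\right).$$
   Context: Let $d\ge 1$, $T\ge1$. A task is a pair $(X_m,y_m)$ with $X_m\in\mathbb{R}^{n_m\times d}$, $y_m\in\mathbb{R}^{n_m}$ and $\operatorname{rank}(X_m)<d$. $\mathcal{S}_T$ denotes the set of collections $S=\{(X_m,y_m)\}_{m=1}^T$ of $T$ tasks such that $\|X_m\|\le 1$ (spectral norm) for all $m$ and there exists $w\in\mathbb{R}^d$ with $\|w\|\le 1$ and $y_m=X_mw$ for all $m$. Given $S$ and an ordering $\tau:\mathbb{N}^+\to\{1,\dots,T\}$, the iterates are $w_0=0$ and $w_t=w_{t-1}+X_{\tau(t)}^+(y_{\tau(t)}-X_{\tau(t)}w_{t-1})$, with $A^+$ the Moore–Penrose pseudoinverse. The forgetting at iteration $k$ is $F_{\tau,S}(k)=\frac1k\sum_{t=1}^k\|X_{\tau(t)}w_k-y_{\tau(t)}\|^2$. The cyclic ordering is $\tau(t)=((t-1)\bmod T)+1$. *)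

(* Defs.v *)
From HB Require Import structures.
From mathcomp Require Import all_boot all_order all_algebra.
From mathcomp Require Import all_classical all_reals all_analysis.
Set Implicit Arguments. Unset Strict Implicit. Unset Printing Implicit Defensive.
Import Order.TTheory GRing.Theory Num.Theory.
Local Open Scope classical_set_scope.
Local Open Scope ring_scope.

Section Defs.
Variable R : realType.

Definition vnorm (n : nat) (v : 'cV[R]_n) : R :=
  Num.sqrt (\sum_(i < n) v i ord0 ^+ 2).

Definition specnorm (m n : nat) (A : 'M[R]_(m, n)) : R :=
  sup [set vnorm (A *m v) | v in [set v : 'cV[R]_n | vnorm v <= 1]].

Definition penrose (m n : nat) (A : 'M[R]_(m, n)) (B : 'M[R]_(n, m)) : Prop :=
  [/\ A *m B *m A = A, B *m A *m B = B,
      (A *m B)^T = A *m B & (B *m A)^T = B *m A].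

Definition mpinv (m n : nat) (A : 'M[R]_(m, n)) : 'M[R]_(n, m) :=
  xget 0 [set B | penrose A B].

Definition task (d : nat) := {n : nat & ('M[R]_(n, d) * 'cV[R]_n)%type}.
Definition tX d (t : task d) : 'M[R]_(projT1 t, d) := (projT2 t).1.
Definition ty d (t : task d) : 'cV[R]_(projT1 t) := (projT2 t).2.

Definition S_T (d T : nat) : set ('I_T -> task d) :=
  [set S | (forall m, \rank (tX (S m)) < d)%N /\
           (forall m, specnorm (tX (S m)) <= 1) /\
           exists w : 'cV[R]_d, vnorm w <= 1 /\
             forall m, ty (S m) = tX (S m) *m w].

(* Iterates w_t for an ordering tau : N^+ -> {1..T} (tau 0 is unused) *)
Fixpoint iterate (d T : nat) (S : 'I_T -> task d) (tau : nat -> 'I_T)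
    (t : nat) : 'cV[R]_d :=
  match t with
  | 0 => 0
  | t'.+1 => let w := iterate S tau t' in
             w + mpinv (tX (S (tau t))) *m (ty (S (tau t)) - tX (S (tau t)) *m w)
  end.

Definition forgetting (d T : nat) (tau : nat -> 'I_T) (S : 'I_T -> task d)
    (k : nat) : R :=
  k%:R^-1 * \sum_(1 <= t < k.+1)
     vnorm (tX (S (tau t)) *m iterate S tau k - ty (S (tau t))) ^+ 2.

End Defs.

(* Cyclic ordering on T.+1 tasks: tau(t) = ((t-1) mod T.+1) + 1, 0-indexed *)
Definition cyclic_order (T : nat) (t : nat) : 'I_T.+1 :=
  inord ((t.-1) %% T.+1).

(* Main.v *)
(** Writing [P_t] for the orthogonal projector onto the kernel of the task met at
    step [t], the error [e_t = w - w_t] satisfies [e_{t+1} = P_{t+1} e_t], so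
    [F(2n) = |X_1 e_{2n}|^2 / 2] is at most half of [|e_{2n}|^2 - |e_{2n+1}|^2].
    As the projectors alternate, [<e_t, e_{t+2}> = |e_{t+1}|^2]; by Cauchy-Schwarz
    the sequence [f_j = |e_{j+1}|^2] is log-convex.  It is also nonincreasing with
    [f_0 <= 1], hence with [m = 2n - 1] and [c = f_{m+1} / f_m] one gets
    [f_m - f_{m+1} <= c^m (1 - c) <= m^m / (m+1)^{m+1}].  Two lines at an angle of
    squared cosine [m / (m+1)] reach this bound, so the supremum is exactly
    [m^m / (2 (m+1)^{m+1})]; expanding [ln (1 + 1/m)] gives the asymptotics. *)
Require Import Defs.
From HB Require Import structures.
From mathcomp Require Import all_boot all_order all_algebra.
From mathcomp Require Import all_classical all_reals all_analysis.
From mathcomp Require Import ring lra zify.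
Import Order.TTheory GRing.Theory Num.Theory.
Import numFieldNormedType.Exports.
Local Open Scope classical_set_scope.
Local Open Scope ring_scope.
Set Implicit Arguments. Unset Strict Implicit.

(** * Euclidean inner product and the spectral norm *)

Section InnerProduct.
Context {R : realType}.

Definition dot {n : nat} (u v : 'cV[R]_n) : R := \sum_i u i ord0 * v i ord0.

Lemma dotE n (u v : 'cV[R]_n) : u^T *m v = (dot u v)%:M.
Proof.
apply/matrixP=> i j; rewrite !mxE !ord1 eqxx mulr1n.
by apply: eq_bigr => l _; rewrite !mxE.
Qed.

Lemma dotC n (u v : 'cV[R]_n) : dot u v = dot v u.
Proof. by apply: eq_bigr => i _; rewrite mulrC. Qed.

Lemma dotDl n (u v w : 'cV[R]_n) : dot (u + v) w = dot u w + dot v w.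
Proof. by rewrite -big_split; apply: eq_bigr => i _; rewrite mxE mulrDl. Qed.

Lemma dotZl n a (u v : 'cV[R]_n) : dot (a *: u) v = a * dot u v.
Proof. by rewrite /dot mulr_sumr; apply: eq_bigr => i _; rewrite mxE mulrA. Qed.

Lemma dotNl n (u v : 'cV[R]_n) : dot (- u) v = - dot u v.
Proof. by rewrite -scaleN1r dotZl mulN1r. Qed.

Lemma dotDr n (u v w : 'cV[R]_n) : dot w (u + v) = dot w u + dot w v.
Proof. by rewrite dotC dotDl !(dotC w). Qed.

Lemma dotZr n a (u v : 'cV[R]_n) : dot u (a *: v) = a * dot u v.
Proof. by rewrite dotC dotZl dotC. Qed.

Lemma dotNr n (u v : 'cV[R]_n) : dot u (- v) = - dot u v.
Proof. by rewrite dotC dotNl dotC. Qed.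

Definition dot_lin := (dotDl, dotDr, dotZl, dotZr, dotNl, dotNr).

Lemma dot_ge0 n (v : 'cV[R]_n) : 0 <= dot v v.
Proof. by apply: sumr_ge0 => i _; rewrite -expr2 sqr_ge0. Qed.

Lemma dot_eq0 n (v : 'cV[R]_n) : dot v v = 0 -> v = 0.
Proof.
move=> /eqP; rewrite psumr_eq0; last by move=> i _; rewrite -expr2 sqr_ge0.
move=> /allP v0; apply/matrixP=> i j; rewrite ord1 mxE; apply/eqP.
by have := v0 i (mem_index_enum _); rewrite mulf_eq0 orbb.
Qed.

Lemma dot0l n (v : 'cV[R]_n) : dot 0 v = 0.
Proof. by rewrite -(scale0r 0) dotZl mul0r. Qed.

Lemma dot_mull m n (A : 'M[R]_(m, n)) u v : dot (A *m u) v = dot u (A^T *m v).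
Proof.
apply: (@fmorph_inj _ _ idfun) => /=.
have : (A *m u)^T *m v = u^T *m (A^T *m v) by rewrite trmx_mul mulmxA.
by rewrite !dotE => /matrixP/(_ ord0 ord0); rewrite !mxE eqxx !mulr1n.
Qed.

Lemma dot_CS n (u v : 'cV[R]_n) : dot u v ^+ 2 <= dot u u * dot v v.
Proof.
have [v0|vn0] := eqVneq (dot v v) 0.
  by rewrite (dot_eq0 v0) dotC !dot0l mulr0 expr0n.
have vgt : 0 < dot v v by rewrite lt_def vn0 dot_ge0.
have := dot_ge0 (dot v v *: u - dot u v *: v).
rewrite !dot_lin (dotC v u) => h.
rewrite -(ler_pM2l vgt); move: h; rewrite -subr_ge0 => h.
rewrite -subr_ge0; nra.
Qed.

Lemma vnormE n (v : 'cV[R]_n) : vnorm v = Num.sqrt (dot v v).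
Proof. by congr Num.sqrt; apply: eq_bigr => i _; rewrite expr2. Qed.

Lemma vnorm_sqr n (v : 'cV[R]_n) : vnorm v ^+ 2 = dot v v.
Proof. by rewrite vnormE sqr_sqrtr ?dot_ge0. Qed.

Lemma vnorm_ge0 n (v : 'cV[R]_n) : 0 <= vnorm v.
Proof. exact: sqrtr_ge0. Qed.

Lemma vnorm_le1 n (v : 'cV[R]_n) : (vnorm v <= 1) = (dot v v <= 1).
Proof. by rewrite -vnorm_sqr expr_le1 ?vnorm_ge0. Qed.

Lemma vnorm0 n : vnorm (0 : 'cV[R]_n) = 0.
Proof. by rewrite vnormE dot0l sqrtr0. Qed.

Lemma vnormZ n a (v : 'cV[R]_n) : vnorm (a *: v) = `|a| * vnorm v.
Proof. by rewrite !vnormE dotZl dotZr mulrA -expr2 sqrtrM ?sqr_ge0 // sqrtr_sqr. Qed.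

(** [sup] dominates its set only when the set is bounded; Cauchy-Schwarz on each row gives the
    Frobenius norm as a bound. *)
Lemma specnorm_has_ubound m n (A : 'M[R]_(m, n)) :
  has_ubound [set vnorm (A *m v) | v in [set v : 'cV[R]_n | vnorm v <= 1]].
Proof.
pose r i := (row i A)^T.
exists (Num.sqrt (\sum_i dot (r i) (r i))) => _ [v /= v1 <-].
rewrite vnormE ler_wsqrtr // /dot; apply: ler_sum => i _; rewrite -expr2.
have -> : (A *m v) i ord0 = dot (r i) v.
  by rewrite mxE; apply: eq_bigr => j _; rewrite !mxE.
apply: le_trans (dot_CS _ _) _.
by rewrite ler_piMr ?dot_ge0 // -vnorm_le1.
Qed.

Lemma specnorm_le1 m n (A : 'M[R]_(m, n)) v :
  specnorm A <= 1 -> dot (A *m v) (A *m v) <= dot v v.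
Proof.
move=> A1; have [v0|vn0] := eqVneq (dot v v) 0.
  by rewrite (dot_eq0 v0) mulmx0 !dot0l.
have vgt : 0 < vnorm v by rewrite vnormE sqrtr_gt0 lt_def vn0 dot_ge0.
rewrite -!vnorm_sqr ler_sqr ?nnegrE ?vnorm_ge0 //.
have : vnorm (A *m ((vnorm v)^-1 *: v)) <= 1.
  apply: le_trans A1; apply: ub_le_sup; first exact: specnorm_has_ubound.
  exists ((vnorm v)^-1 *: v) => //=.
  by rewrite vnormZ ger0_norm ?invr_ge0 ?vnorm_ge0 // mulVf ?gt_eqF.
rewrite -scalemxAr vnormZ ger0_norm ?invr_ge0 ?vnorm_ge0 //.
by rewrite ler_pdivrMl // mulr1.
Qed.

Lemma specnorm_row_le1 n (u : 'cV[R]_n) : dot u u <= 1 -> specnorm u^T <= 1.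
Proof.
move=> u1; apply: ge_sup.
  by exists 0, 0; rewrite /= ?mulmx0 vnorm0.
move=> _ [v /= v1 <-]; rewrite vnorm_le1 dotE.
rewrite /dot big_ord1 mxE eqxx mulr1n -expr2.
apply: le_trans (dot_CS _ _) _.
by rewrite mulr_ile1 ?dot_ge0 // -vnorm_le1.
Qed.

End InnerProduct.

(** * Pseudoinverse and the orthogonal projector onto the kernel *)

Section PseudoInverse.
Context {R : realType}.

(** If v A A^T = 0, then |v A|^2 = v A A^T v^T = 0, so v A = 0, and independence of the rows gives v
    = 0. *)
Lemma row_free_gram_unit m n (A : 'M[R]_(m, n)) :
  row_free A -> A *m A^T \in unitmx.
Proof.
move=> fA; rewrite -row_free_unit -kermx_eq0; apply/rowV0P => v /sub_kermxP vA.
have vA0 : v *m A = 0.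
  apply/trmx_inj; rewrite trmx0; apply: dot_eq0.
  have : (v *m A) *m (v *m A)^T = 0.
    by rewrite trmx_mul mulmxA -(mulmxA v) vA mul0mx.
  rewrite -{1}[v *m A]trmxK dotE => /matrixP/(_ ord0 ord0).
  by rewrite !mxE eqxx mulr1n.
by apply: (row_free_inj fA); rewrite vA0 mul0mx.
Qed.

(** The classical closed form from a full-rank factorization. It serves existence: [xget] in [mpinv]
    then picks a genuine Penrose inverse rather than its default 0. *)
Lemma penrose_factor m r n (C : 'M[R]_(m, r)) (Q : 'M[R]_(r, n)) :
  C^T *m C \in unitmx -> Q *m Q^T \in unitmx ->
  penrose (C *m Q) (Q^T *m invmx (Q *m Q^T) *m invmx (C^T *m C) *m C^T).
Proof.
move=> uC uQ; set GQ := invmx (Q *m Q^T); set GC := invmx (C^T *m C).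
set B := _ *m C^T.
have AB : (C *m Q) *m B = C *m GC *m C^T.
  by rewrite /B !mulmxA -(mulmxA C Q) -(mulmxA C) mulmxV // mulmx1.
have BA : B *m (C *m Q) = Q^T *m GQ *m Q.
  by rewrite /B -!mulmxA (mulmxA C^T C) (mulmxA GC) mulVmx // mul1mx.
have sQ : GQ^T = GQ by rewrite /GQ trmx_inv trmx_mul trmxK.
have sC : GC^T = GC by rewrite /GC trmx_inv trmx_mul trmxK.
split.
- by rewrite AB -!mulmxA (mulmxA C^T C) (mulmxA GC) mulVmx // mul1mx.
- rewrite BA /B -!mulmxA (mulmxA Q Q^T) (mulmxA GQ (Q *m Q^T)) mulVmx //.
  by rewrite mul1mx.
- by rewrite AB !trmx_mul trmxK sC mulmxA.
- by rewrite BA !trmx_mul trmxK sQ mulmxA.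
Qed.

Lemma penrose_exists m n (A : 'M[R]_(m, n)) : exists B, penrose A B.
Proof.
rewrite -{1}(mulmx_base A); eexists; apply: penrose_factor.
  rewrite -{2}[col_base A]trmxK; apply: row_free_gram_unit.
  by rewrite /row_free mxrank_tr; exact: col_base_full.
by apply: row_free_gram_unit; exact: row_base_free.
Qed.

Lemma mpinvP m n (A : 'M[R]_(m, n)) : penrose A (mpinv A).
Proof. exact: xgetPex (penrose_exists A). Qed.

(** Write B for the pseudoinverse. The equation A B A = A forces [u^T *m B] to be 1, and symmetry of
    [B *m u^T], applied to u, then gives B = u. *)
Lemma mpinv_row n (u : 'cV[R]_n) : dot u u = 1 -> mpinv u^T = u.
Proof.
move=> u1; have [ABA _ _ sBA] := mpinvP u^T.
set B := mpinv u^T in ABA sBA *.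
have uu : u^T *m u = 1%:M by rewrite dotE u1.
have AB : u^T *m B = 1%:M.
  by have := congr1 (mulmx^~ u) ABA; rewrite -mulmxA uu mulmx1.
have : (B *m u^T) *m u = (B *m u^T)^T *m u by rewrite sBA.
rewrite trmx_mul trmxK -!mulmxA uu mulmx1 -(trmxK (B^T *m u)).
by rewrite trmx_mul trmxK AB trmx1 mulmx1.
Qed.

Definition kerproj {m n : nat} (A : 'M[R]_(m, n)) : 'M[R]_n :=
  1%:M - mpinv A *m A.

Lemma kerproj_sym m n (A : 'M[R]_(m, n)) : (kerproj A)^T = kerproj A.
Proof. by have [_ _ _ s] := mpinvP A; rewrite /kerproj linearB /= s trmx1. Qed.

Lemma mul_kerproj m n (A : 'M[R]_(m, n)) : A *m kerproj A = 0.
Proof. by have [s _ _ _] := mpinvP A; rewrite mulmxBr mulmx1 mulmxA s subrr. Qed.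

Lemma kerproj_idem m n (A : 'M[R]_(m, n)) : kerproj A *m kerproj A = kerproj A.
Proof. by rewrite {1}/kerproj mulmxBl mul1mx -mulmxA mul_kerproj mulmx0 subr0. Qed.

Lemma dot_kerproj m n (A : 'M[R]_(m, n)) u v :
  dot (kerproj A *m u) (kerproj A *m v) = dot u (kerproj A *m v).
Proof. by rewrite dot_mull kerproj_sym mulmxA kerproj_idem. Qed.

Lemma kerproj_contr m n (A : 'M[R]_(m, n)) v :
  dot (kerproj A *m v) (kerproj A *m v) <= dot v v.
Proof.
have := dot_ge0 (v - kerproj A *m v); rewrite !dot_lin dot_kerproj.
by rewrite (dotC (kerproj A *m v) v); lra.
Qed.

(** [A] sees only the part of [v] orthogonal to its kernel, whose squared norm is given by
    Pythagoras. *)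
Lemma dot_mul_le_kerproj m n (A : 'M[R]_(m, n)) v : specnorm A <= 1 ->
  dot (A *m v) (A *m v) <= dot v v - dot (kerproj A *m v) (kerproj A *m v).
Proof.
move=> A1; have -> : A *m v = A *m (v - kerproj A *m v).
  by rewrite mulmxBr mulmxA mul_kerproj mul0mx subr0.
apply: le_trans (specnorm_le1 _ A1) _.
by rewrite !dot_lin dot_kerproj (dotC (kerproj A *m v) v); lra.
Qed.

Lemma kerproj_row n (u v : 'cV[R]_n) : dot u u = 1 ->
  kerproj u^T *m v = v - dot u v *: u.
Proof.
by move=> u1; rewrite mulmxBl mul1mx mpinv_row // -mulmxA dotE mul_mx_scalar.
Qed.

End PseudoInverse.

(** * An elementary maximum and its asymptotics *)

Section PeakValue.
Context {R : realType}.

(** The maximum of x^m (1 - x) over x >= 0, taken at x = m / (m + 1). *)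
Definition peak (m : nat) : R := (m%:R / m.+1%:R) ^+ m / m.+1%:R.

Lemma bernoulli_tangent m (y : R) : 0 <= y ->
  m.+1%:R * y ^+ m <= m%:R * y ^+ m.+1 + 1.
Proof.
move=> y0; elim: m => [|m IH]; first by rewrite expr0; lra.
(* Once the induction hypothesis is multiplied by y, exactly this product remains to be added; its
   factors have the same sign. *)
have h : 0 <= (y - 1) * (y ^+ m.+1 - 1).
  have [y1|y1] := leP 1 y.
    by rewrite mulr_ge0 // subr_ge0 // exprn_ege1.
  by rewrite mulr_le0 // subr_le0 ?exprn_ile1 // ltW.
have := ler_wpM2l y0 IH; move: h; rewrite !exprS -!natr1.
set p := y ^+ m; set a := m%:R; nra.
Qed.

(** Measuring x in units of the maximiser c = m / (m + 1), as x = c y, turns the claim into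
    [bernoulli_tangent]. *)
Lemma le_peak m (x : R) : (0 < m)%N -> 0 <= x -> x ^+ m * (1 - x) <= peak m.
Proof.
move=> m0 x0; rewrite /peak; set c : R := m%:R / _.
have M0 : 0 < m.+1%:R :> R by rewrite ltr0n.
have c0 : 0 < c by rewrite divr_gt0 ?ltr0n.
have e : c * m.+1%:R = m%:R by rewrite /c divfK ?gt_eqF.
clearbody c; have -> : x = c * (x / c) by rewrite mulrC divfK ?gt_eqF.
have := @bernoulli_tangent m (x / c) (divr_ge0 x0 (ltW c0)).
move: (x / c) => y h; rewrite ler_pdivlMr // exprMn -!mulrA ler_piMr //.
  by rewrite exprn_ge0 // ltW.
by move: h; rewrite exprS -e; lra.
Qed.

Lemma ndecr0_ge0 (f f' : R -> R) (x : R) : 0 <= x -> f 0 = 0 ->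
  (forall y : R, 0 <= y -> is_derive y 1 f (f' y)) ->
  (forall y : R, 0 <= y -> 0 <= f' y) -> 0 <= f x.
Proof.
move=> x0 f0 df f'0; rewrite -f0.
apply: (@ger0_derive1_ndecr R f 0 x) => //.
- by move=> y; rewrite in_itv => /andP[/ltW y0 _]; have [] := df y y0.
- move=> y; rewrite in_itv => /andP[/ltW y0 _]; rewrite derive1E.
  by have [_ ->] := df y y0; exact: f'0.
- apply: derivable_within_continuous => y; rewrite in_itv => /andP[y0 _].
  by have [] := df y y0.
Qed.

Lemma ln1Dx_ge (x : R) : 0 <= x -> x - x ^+ 2 / 2 <= ln (1 + x).
Proof.
move=> x0; rewrite -subr_ge0.
apply: (@ndecr0_ge0 (fun y => ln (1 + y) - (y - y ^+ 2 / 2))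
  (fun y => y ^+ 2 / (1 + y))); first by [].
- by rewrite addr0 ln1 expr0n /= mul0r !subr0.
- move=> y y0; have y1 : 0 < 1 + y by lra.
  have := is_derive1_ln y1 => dln.
  apply: is_derive_eq; rewrite !scaler1 /GRing.scale /=.
  by field; lra.
- by move=> y y0; rewrite divr_ge0 ?sqr_ge0 //; lra.
Qed.

Lemma ln1Dx_le (x : R) : 0 <= x -> ln (1 + x) <= x - x ^+ 2 / 2 + x ^+ 3 / 3.
Proof.
move=> x0; rewrite -subr_ge0.
apply: (@ndecr0_ge0 (fun y => (y - y ^+ 2 / 2 + y ^+ 3 / 3) - ln (1 + y))
  (fun y => y ^+ 3 / (1 + y))); first by [].
- by rewrite addr0 ln1 !expr0n /= !mul0r !subr0 addr0.
- move=> y y0; have y1 : 0 < 1 + y by lra.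
  have := is_derive1_ln y1 => dln.
  apply: is_derive_eq; rewrite !scaler1 /GRing.scale /=.
  by field; lra.
- by move=> y y0; rewrite divr_ge0 ?exprn_ge0 //; lra.
Qed.

(** [peak m] equals 1 / (m (1 + 1/m)^(m+1)); the factor e is split off so that the remaining
    exponent tends to 0. *)
Lemma peak_exp m : (0 < m)%N ->
  peak m = expR (1 - (1 + m%:R) * ln (1 + m%:R^-1)) / (expR 1 * m%:R).
Proof.
move=> m0; have M0 : 0 < m%:R :> R by rewrite ltr0n.
have q : 1 + m%:R^-1 = m.+1%:R / m%:R :> R by rewrite -natr1; field; lra.
have q0 : 0 < m.+1%:R / m%:R :> R by rewrite divr_gt0 ?ltr0n.
rewrite q expRD expRN nat1r expRM_natl lnK ?posrE // -exprVn invf_div.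
rewrite /peak exprS; have := expR_gt0 (1 : R); move: (_ ^+ m) => p e0.
by rewrite -nat1r; field; rewrite !lt0r_neq0 //; lra.
Qed.

(** With x = 1/m this controls the numerator in [peak_exp]. Multiplying the Taylor bounds on [ln] by
    1 + 1/x shows that the exponent is -x/2 + O(x^2). *)
Lemma expR_ln_bounds (x : R) : 0 < x <= 1 ->
  `|expR (1 - (1 + x^-1) * ln (1 + x)) - (1 - x / 2)| <= x ^+ 2.
Proof.
move=> /andP[x0 x1]; set h := 1 - _.
have xV : 0 < 1 + x^-1 by rewrite addr_gt0 ?invr_gt0.
have hu : h <= - (x / 2) + x ^+ 2 / 2.
  have := ler_wpM2l (ltW xV) (ln1Dx_ge (ltW x0)).
  have -> : (1 + x^-1) * (x - x ^+ 2 / 2) = 1 + x / 2 - x ^+ 2 / 2.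
    by field; lra.
  by rewrite /h; lra.
have hl : - (x / 2) + x ^+ 2 / 6 - x ^+ 3 / 3 <= h.
  have := ler_wpM2l (ltW xV) (ln1Dx_le (ltW x0)).
  have -> : (1 + x^-1) * (x - x ^+ 2 / 2 + x ^+ 3 / 3)
            = 1 + x / 2 - x ^+ 2 / 6 + x ^+ 3 / 3.
    by field; lra.
  by rewrite /h; lra.
have x2 : x ^+ 3 <= x ^+ 2 by rewrite exprS; have := sqr_ge0 x; nra.
have x20 := sqr_ge0 x.
rewrite ler_distl; apply/andP; split; first by have := expR_ge1Dx h; lra.
(* For the upper half, exp(-h) >= 1 - h inverts to exp h <= 1 / (1 - h), which leaves a polynomial
   inequality in x. *)
have h1 : 0 < 1 - h by nra.
have le1 : expR h <= (1 - h)^-1.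
  rewrite -[h in expR h]opprK expRN lef_pV2 ?posrE ?expR_gt0 //.
  by rewrite expR_ge1Dx.
apply: le_trans le1 _.
have b0 : 0 < 1 + x / 2 - x ^+ 2 / 2 by nra.
apply: (@le_trans _ _ (1 + x / 2 - x ^+ 2 / 2)^-1).
  by rewrite lef_pV2 ?posrE //; lra.
rewrite -div1r ler_pdivrMr //.
have x4 : x ^+ 4 <= x ^+ 2 by rewrite (exprD _ 2 2); nra.
have x30 : 0 <= x ^+ 3 by rewrite exprn_ge0 // ltW.
have -> : (1 - x / 2 + x ^+ 2) * (1 + x / 2 - x ^+ 2 / 2)
   = 1 + x ^+ 2 / 4 + 3 / 4 * x ^+ 3 - x ^+ 4 / 2 by field.
have x43 : x ^+ 4 <= x ^+ 3 by rewrite (exprS _ 3); nra.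
by lra.
Qed.

Lemma peak_asymptotics m : (0 < m)%N ->
  `|peak m / 2 - ((2 * expR 1 * m%:R)^-1 - (4 * expR 1 * m%:R ^+ 2)^-1)|
    <= m%:R ^- 3.
Proof.
move=> m0; have M0 : 0 < m%:R :> R by rewrite ltr0n.
have M1 : 1 <= m%:R :> R by rewrite ler1n.
have := @expR_ln_bounds (m%:R^-1).
rewrite invr_gt0 M0 invf_le1 // M1 invrK => /(_ isT).
rewrite peak_exp //; move: (expR (1 - _)) => g.
have e1 : 1 <= expR 1 :> R by have := expR_ge1Dx (1 : R); lra.
move: (expR 1) e1 => e e1 hg.
have e0 : 0 < e by lra.
have -> : g / (e * m%:R) / 2 - ((2 * e * m%:R)^-1 - (4 * e * m%:R ^+ 2)^-1)
  = (2 * e * m%:R)^-1 * (g - (1 - m%:R^-1 / 2)).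
  by field; rewrite !lt0r_neq0.
have p0 : 0 < 2 * e * m%:R by rewrite !mulr_gt0.
rewrite normrM gtr0_norm ?invr_gt0 //.
(* One factor 1/m comes from the prefactor, where e >= 1, and two from [expR_ln_bounds] at x =
   1/m. *)
apply: (@le_trans _ _ (m%:R^-1 * m%:R^-1 ^+ 2)).
  apply: ler_pM; rewrite ?invr_ge0 ?(ltW p0) //.
  by rewrite lef_pV2 ?posrE //; nra.
by rewrite -exprS exprVn.
Qed.

End PeakValue.

(** * Drops of log-convex sequences *)

Section LogConvex.
Context {R : realType}.

Lemma log_convex_drop_le (f : nat -> R) m : (0 < m)%N ->
  (forall j, 0 <= f j) -> (forall j, f j.+1 <= f j) -> f 0%N <= 1 ->
  (forall j, f j.+1 ^+ 2 <= f j * f j.+2) ->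
  f m - f m.+1 <= peak m.
Proof.
move=> m0 f0 fd f1 fc.
(* Successive ratios increase and f_0 <= 1, so f_j <= (f_{j+1} / f_j)^j; written without division,
   this also covers vanishing terms. *)
have key j : f j ^+ j.+1 <= f j.+1 ^+ j.
  elim: j => [|j IH]; first by rewrite expr1 expr0.
  have [z|nz] := eqVneq (f j.+1) 0.
    by rewrite z expr0n /= exprn_ge0.
  have p0 : 0 < f j.+1 by rewrite lt_def nz f0.
  have pj : 0 < f j.+1 ^+ j by rewrite exprn_gt0.
  rewrite -(ler_pM2l pj) -exprD.
  have -> : (j + j.+2 = 2 * j.+1)%N by lia.
  rewrite exprM.
  apply: (@le_trans _ _ ((f j * f j.+2) ^+ j.+1)).
    by rewrite lerXn2r ?nnegrE ?sqr_ge0 ?mulr_ge0.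
  by rewrite exprMn ler_wpM2r ?exprn_ge0.
have [z|nz] := eqVneq (f m) 0.
  have p0 : 0 <= peak m :> R.
    by rewrite divr_ge0 ?exprn_ge0 ?divr_ge0 ?ler0n.
  by apply: le_trans p0; rewrite z sub0r oppr_le0.
have fm : 0 < f m by rewrite lt_def nz f0.
have fmc : f m <= (f m.+1 / f m) ^+ m.
  by rewrite expr_div_n ler_pdivlMr ?exprn_gt0 // -exprS key.
apply: le_trans (le_peak m0 (divr_ge0 (f0 m.+1) (ltW fm))).
have -> : f m - f m.+1 = f m * (1 - f m.+1 / f m) by field.
by rewrite ler_wpM2r // subr_ge0 ler_pdivrMr // mul1r.
Qed.

End LogConvex.

(** * Upper bound for two alternating tasks *)

Section TwoTasks.
Context {R : realType}.
Variables (d : nat) (S : 'I_2 -> task R d) (w : 'cV[R]_d).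
Hypothesis Sw : forall m, ty (S m) = tX (S m) *m w.

Local Notation tau := (cyclic_order 1).
Local Notation P t := (kerproj (tX (S (tau t)))).

Definition err t : 'cV[R]_d := w - iterate S tau t.

Lemma errS t : err t.+1 = P t.+1 *m err t.
Proof.
by rewrite /err /= Sw -mulmxBr mulmxBl mul1mx mulmxA opprD addrA.
Qed.

(** The period starts at index 1: the truncated predecessor in [cyclic_order] makes [tau 0] equal to
    [tau 1]. *)
Lemma tauSS t : tau t.+3 = tau t.+1.
Proof. by congr inord; exact: (modnDl 2 t). Qed.

Lemma tau_odd n : tau (2 * n).+1 = ord0.
Proof. by apply/val_inj; rewrite /= inordK ?ltn_pmod // modnMr. Qed.

Lemma tau_even n : tau (2 * n.+1) = ord_max.
Proof.
apply/val_inj; rewrite /= inordK ?ltn_pmod //.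
by rewrite mulnS /= -addn1 addnC mulnC modnMDl.
Qed.

(** Step 2n has just solved the second task, so only the n visits to the first one count, and n /
    (2n) = 1/2. *)
Lemma forgetting_even n : (0 < n)%N ->
  forgetting tau S (2 * n) =
  vnorm (tX (S ord0) *m err (2 * n)) ^+ 2 / 2.
Proof.
case: n => // n _; rewrite /forgetting.
pose G i := vnorm (tX (S i) *m iterate S tau (2 * n.+1) - ty (S i)) ^+ 2.
have GE i : G i = vnorm (tX (S i) *m err (2 * n.+1)) ^+ 2.
  by rewrite /G Sw -mulmxBr -opprB mulmxN !vnorm_sqr dotNl dotNr opprK.
have G1 : G ord_max = 0.
  rewrite GE; have -> : err (2 * n.+1) = P (2 * n.+1) *m err (2 * n).+1.
    by rewrite mulnS; exact: errS.
  by rewrite tau_even mulmxA mul_kerproj mul0mx vnorm0 expr0n.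
have sumG p : \sum_(1 <= t < (2 * p).+1) G (tau t) = p%:R * G ord0.
  elim: p => [|p IH]; first by rewrite big_geq // mul0r.
  rewrite mulnS 2?big_nat_recr //= IH tau_odd.
  have -> : tau (2 * p).+2 = ord_max by rewrite -(tau_even p) mulnS.
  by rewrite G1 addr0 -nat1r mulrDl mul1r addrC.
rewrite (sumG n.+1) GE natrM; set g := _ ^+ 2.
by field; rewrite nat1r pnatr_eq0.
Qed.

Lemma forgetting_le_peak n : (0 < n)%N ->
  (forall m, specnorm (tX (S m)) <= 1) -> vnorm w <= 1 ->
  forgetting tau S (2 * n) <= peak (2 * n).-1 / 2.
Proof.
case: n => // n _ X1 w1; rewrite forgetting_even // vnorm_sqr.
rewrite ler_pM2r ?invr_gt0 ?ltr0n //.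
apply: le_trans (dot_mul_le_kerproj _ (X1 _)) _.
(* The sequence starts at [err 1], since [err 0], which is [w], need not lie in the range of a
   projector. *)
pose f j := dot (err j.+1) (err j.+1).
(* Step 2n + 1 would visit the first task again, so the bound is a drop between consecutive terms of
   [f]. *)
have <- : P (2 * n.+1).+1 = kerproj (tX (S ord0)) by rewrite tau_odd.
rewrite -errS mulnS /=.
apply: (@log_convex_drop_le R f (2 * n).+1) => // [j|j||j].
- exact: dot_ge0.
- by rewrite /f (errS j.+1) kerproj_contr.
- rewrite /f errS; apply: le_trans (kerproj_contr _ _) _.
  by rewrite /err subr0 -vnorm_le1.
(* By self-adjointness the last projector moves onto [err j.+1], which it fixes because steps j + 1
   and j + 3 meet the same task. *)
- have -> : f j.+1 = dot (err j.+1) (err j.+3).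
    have Perr : P j.+3 *m err j.+1 = err j.+1.
      by rewrite errS mulmxA tauSS kerproj_idem.
    rewrite (errS j.+2) [RHS]dotC dot_mull kerproj_sym Perr dotC /f (errS j.+1).
    by rewrite dot_kerproj.
  exact: dot_CS.
Qed.

End TwoTasks.

(** * Sharpness: two lines in a plane *)

Section Extremal.
Context {R : realType}.
Variables (d : nat) (p q : 'cV[R]_d) (c s : R).
Hypotheses (pp : dot p p = 1) (qq : dot q q = 1) (pq : dot p q = 0).
Hypothesis cs : c ^+ 2 + s ^+ 2 = 1.

(** A unit normal, within the plane of [p] and [q], to the line spanned by c p + s q. *)
Let u := c *: q - s *: p.

(* The solution spaces [q^⊥] and [u^⊥] meet the plane [<p, q>] in two lines at
   an angle with cosine [c]; the target [p] lies on the first one. *)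
Definition line_task (i : 'I_2) : task R d :=
  let v := if i == ord0 then q else u in existT _ 1%N (v^T, v^T *m p).

Lemma line_task_consistent i : ty (line_task i) = tX (line_task i) *m p.
Proof. by []. Qed.

Let uu : dot u u = 1.
Proof. by rewrite /u !dot_lin pp qq (dotC q p) pq; have := cs; lra. Qed.

Lemma line_task_S_T : (1 < d)%N -> S_T line_task.
Proof.
move=> d1; split; [|split].
- by move=> i; apply: leq_ltn_trans d1; exact: rank_leq_row.
- by move=> i; apply: specnorm_row_le1; case: ifP; rewrite ?qq ?uu.
- by exists p; split=> //; rewrite vnorm_le1 pp.
Qed.

Let kerproj_q v : kerproj (tX (line_task ord0)) *m v = v - dot q v *: q.
Proof. exact: kerproj_row. Qed.

Let kerproj_u v : kerproj (tX (line_task ord_max)) *m v = v - dot u v *: u.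
Proof. exact: kerproj_row. Qed.

(** The first step leaves the error at [p], already orthogonal to [q]; each later step projects one
    line onto the other and shrinks the error by c. *)
Lemma line_task_err n :
  err line_task p (2 * n.+1) = c ^+ (2 * n).+1 *: (c *: p + s *: q).
Proof.
have errS t := errS line_task_consistent t.
have even_odd k : err line_task p (2 * k).+1 = c ^+ (2 * k) *: p ->
    err line_task p (2 * k.+1) = c ^+ (2 * k).+1 *: (c *: p + s *: q).
  move=> e; have -> : err line_task p (2 * k.+1) =
      kerproj (tX (line_task ord_max)) *m err line_task p (2 * k).+1.
    by rewrite -(tau_even k) mulnS; exact: errS.
  rewrite kerproj_u e /u !dot_lin pp (dotC q p) pq exprS.
  move: (c ^+ _) => a; apply/matrixP => i j; rewrite !mxE.
  by have := congr1 ( *%R (a * p i j)) cs; lra.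
have odd k : err line_task p (2 * k).+1 = c ^+ (2 * k) *: p.
  elim: k => [|k IH].
    rewrite muln0 expr0 scale1r.
    have -> : err line_task p 1 =
        kerproj (tX (line_task ord0)) *m err line_task p 0.
      by rewrite -(tau_odd 0); exact: errS.
    by rewrite kerproj_q /err /= subr0 (dotC q) pq scale0r subr0.
  have -> : err line_task p (2 * k.+1).+1 =
      kerproj (tX (line_task ord0)) *m err line_task p (2 * k.+1).
    by rewrite -(tau_odd k.+1); exact: errS.
  rewrite (even_odd _ IH) kerproj_q !dot_lin qq (dotC q) pq mulnS !exprS.
  by move: (c ^+ _) => a; apply/matrixP => i j; rewrite !mxE; ring.
exact: even_odd (odd n).
Qed.

Lemma line_task_forgetting n :
  forgetting (cyclic_order 1) line_task (2 * n.+1) =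
  (c ^+ 2) ^+ (2 * n).+1 * s ^+ 2 / 2.
Proof.
rewrite (forgetting_even line_task_consistent) // line_task_err.
have -> : tX (line_task ord0) = q^T by [].
rewrite vnorm_sqr dotE {1}/dot big_ord1 mxE eqxx mulr1n.
by rewrite !dot_lin qq (dotC q) pq exprAC; field.
Qed.

End Extremal.

(** * The exact supremum and its expansion *)

Lemma forgetting_attains_peak (R : realType) d n : (1 < d)%N ->
  exists2 S, @S_T R d 2 S &
    forgetting (cyclic_order 1) S (2 * n.+1) = peak (2 * n).+1 / 2.
Proof.
move=> d1; pose i0 := Ordinal (ltnW d1); pose i1 := Ordinal d1.
have dotd (i j : 'I_d) :
    dot (delta_mx i ord0) (delta_mx j ord0) = (i == j)%:R :> R.
  rewrite /dot (bigD1 i) //= !mxE !eqxx mul1r andbT big1 ?addr0 // => l /negPf li.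
  by rewrite !mxE li mul0r.
set m := (2 * n).+1; have M0 : 0 < m.+1%:R :> R by rewrite ltr0n.
(* The squared cosine is the maximiser of x^m (1 - x), with m = k - 1. *)
pose c : R := Num.sqrt (m%:R / m.+1%:R); pose s : R := Num.sqrt m.+1%:R^-1.
have c2 : c ^+ 2 = m%:R / m.+1%:R by rewrite sqr_sqrtr // divr_ge0 ?ler0n.
have s2 : s ^+ 2 = m.+1%:R^-1 by rewrite sqr_sqrtr // invr_ge0 ler0n.
have cs : c ^+ 2 + s ^+ 2 = 1.
  by rewrite c2 s2 -{2}[_^-1]mul1r -mulrDl natr1 divff ?gt_eqF.
have e0 := dotd i0 i0; have e1 := dotd i1 i1; have e01 := dotd i0 i1.
rewrite !eqxx in e0 e1.
exists (line_task (delta_mx i0 ord0) (delta_mx i1 ord0) c s).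
  exact: line_task_S_T.
by rewrite line_task_forgetting // c2 s2.
Qed.

Lemma ereal_sup_forgetting (R : realType) d n : (1 < d)%N ->
  ereal_sup [set (forgetting (cyclic_order 1) S (2 * n.+1))%:E
            | S in @S_T R d 2] = (peak (2 * n).+1 / 2)%:E.
Proof.
move=> d1; apply/le_anti/andP; split.
  apply: ge_ereal_sup => _ [S [_ [X1 [w [w1 Sw]]]] <-]; rewrite lee_fin.
  have -> : ((2 * n).+1 = (2 * n.+1).-1)%N by rewrite mulnS.
  exact: (forgetting_le_peak Sw (ltn0Sn n)).
have [S SS <-] := @forgetting_attains_peak R d n d1.
by apply: ereal_sup_ubound; exists S.
Qed.

Theorem mainTheorem5 (R : realType) (d : nat) (hd : (2 <= d)%N) :
  exists C : R, forall n : nat, (1 <= n)%N ->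
    let k := (2 * n)%N in
    exists s : R,
      ereal_sup [set (forgetting (cyclic_order 1) S k)%:E
                | S in @S_T R d 2] = s%:E /\
      `| s - ((2 * expR 1 * (k.-1)%:R)^-1
              - (4 * expR 1 * (k.-1)%:R ^+ 2)^-1) | <= C / k%:R ^+ 3.
Proof.
(* As k <= 2 (k - 1), the error 1 / (k - 1)^3 is at most 2^3 / k^3. *)
exists 8 => -[//|n] _; exists (peak (2 * n).+1 / 2).
split; first exact: ereal_sup_forgetting.
have -> : (2 * n.+1).-1 = (2 * n).+1 by lia.
apply: le_trans (peak_asymptotics _) _ => //.
have -> : (2 * n.+1 = (2 * n).+2)%N by lia.
have M0 : 0 < (2 * n).+1%:R :> R by rewrite ltr0n.
have K0 : 0 < (2 * n).+2%:R :> R by rewrite ltr0n.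
rewrite ler_pdivlMr ?exprn_gt0 // ler_pdivrMl ?exprn_gt0 //.
have -> : (2 * n).+1%:R ^+ 3 * 8 = (2 * (2 * n).+1%:R) ^+ 3 :> R by ring.
by rewrite lerXn2r ?nnegrE ?mulr_ge0 ?ler0n // -natrM ler_nat; lia.
Qed.
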